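(* For every positive integer $r$ and every type $\mathbf m=[m_2,m_3,\ldots]$, let $C^{(r)}_{\mathbf m}=[\mathbf t^{\mathbf m}]\,\mathbf S^r$. Then $$C^{(r)}_{\mathbf m}=\frac{r\,(r-1+2m_2+3m_3+\cdots)!}{(r+m_2+2m_3+\cdots)!\,m_2!\,m_3!\cdots}=\sum_{\substack{\sum_{\mathbf n\ge0}k_{\mathbf n}=r\\ \sum_{\mathbf n\ge0}k_{\mathbf n}\mathbf n=\mathbf m}}\binom{r}{\mathbf k}\prod_{\mathbf n\ge0}C_{\mathbf n}^{k_{\mathbf n}},$$ where the sum runs over families $\mathbf k=(k_{\mathbf n})_{\mathbf n}$ of natural numbers indexed by types, finitely many nonzero, satisfying the constraints, and $\binom{r}{\mathbf k}=r!/\prod_{\mathbf n}k_{\mathbf n}!$.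
   Context: A type is a vector $\mathbf m=[m_2,m_3,m_4,\ldots]$ of natural numbers (indices start at $2$) with finitely many nonzero entries. For variables $t_2,t_3,\ldots$, $\mathbf t^{\mathbf m}=t_2^{m_2}t_3^{m_3}\cdots$ and $[\mathbf t^{\mathbf m}]F$ is the coefficient of $\mathbf t^{\mathbf m}$ in a formal power series $F$. The hyper-Catalan number is $C_{\mathbf m}=\frac{(2m_2+3m_3+4m_4+\cdots)!}{(1+m_2+2m_3+3m_4+\cdots)!\,m_2!\,m_3!\cdots}$ (the number of subdivisions of a roofed polygon into $m_2$ triangles, $m_3$ quadrilaterals, etc.), and $\mathbf S=\sum_{\mathbf m}C_{\mathbf m}\mathbf t^{\mathbf m}$ is its generating series. *)

(* Defs.v *)
From mathcomp Require Import all_boot all_order all_algebra.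
From mathcomp Require Import finmap.
From mathcomp Require Import boolp classical_sets functions cardinality fsbigop.

Set Implicit Arguments.
Unset Strict Implicit.
Unset Printing Implicit Defensive.

Import GRing.Theory.
Local Open Scope classical_set_scope.
Local Open Scope ring_scope.

(* Indices are shifted by 2: for m : mtype, [m i] is the entry m_{i+2}. *)
Notation mtype := {fsfun nat -> nat with 0%N}.

(* Families (k_n)_n of naturals indexed by types, finitely many nonzero. *)
Notation mfamily := {fsfun mtype -> nat with 0%N}.

(* 2 m_2 + 3 m_3 + 4 m_4 + ... *)
Definition edge_weight (m : mtype) : nat :=
  (\sum_(i <- finsupp m) (i + 2) * m i)%N.

(* m_2 + 2 m_3 + 3 m_4 + ... *)
Definition vertex_weight (m : mtype) : nat :=
  (\sum_(i <- finsupp m) (i + 1) * m i)%N.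

(* m_2! m_3! m_4! ... *)
Definition mfact (m : mtype) : nat := (\prod_(i <- finsupp m) (m i)`!)%N.

(* The quotient is taken in rat, so it carries no integrality assumption. *)
Definition hyper_catalan (m : mtype) : rat :=
  (edge_weight m)`!%:R / ((1 + vertex_weight m)`!%:R * (mfact m)%:R).

(* Formal power series over rat in t_2, t_3, ...: [F m] is [t^m]F. *)
Definition mseries := mtype -> rat.

Definition mdecomp (m : mtype) : set (mtype * mtype) :=
  [set p : mtype * mtype | forall i, (p.1 i + p.2 i)%N = m i].

Definition mseries_one : mseries := fun m => (finsupp m == fset0)%:R.

Definition mseries_mul (F G : mseries) : mseries :=
  fun m => \sum_(p \in mdecomp m) F p.1 * G p.2.

Definition mseries_exp (F : mseries) (r : nat) : mseries :=
  iter r (mseries_mul F) mseries_one.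

Definition hyper_catalan_series : mseries := hyper_catalan.

(* C^(r)_m = [t^m] S^r *)
Definition hyper_catalan_pow (r : nat) (m : mtype) : rat :=
  mseries_exp hyper_catalan_series r m.

(* sum_n k_n = r and sum_n k_n n = m, the latter read entrywise *)
Definition composition_families (r : nat) (m : mtype) : set mfamily :=
  [set k : mfamily | (\sum_(n <- finsupp k) k n)%N = r /\
           forall i, (\sum_(n <- finsupp k) k n * n i)%N = m i].

Definition family_multinomial (r : nat) (k : mfamily) : rat :=
  r`!%:R / (\prod_(n <- finsupp k) (k n)`!)%N%:R.

(* The sums over [mdecomp m] and [composition_families r m] use
   \sum_(x \in A), which is 0 by convention on an infinite support; the
   lemmas below show that both index sets are finite. *)

Lemma finite_bounded_fsfun (T : choiceType) (D : {fset T}) (B : nat) :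
  finite_set [set f : {fsfun T -> nat with 0%N} |
              (forall x, x \notin D -> f x = 0%N) /\ forall x, (f x <= B)%N].
Proof.
pose mk (g : {ffun D -> 'I_B.+1}) : {fsfun T -> nat with 0%N} :=
  [fsfun x : D => nat_of_ord (g x) | 0%N].
apply: (@sub_finite_set _ _ (mk @` setT)); last first.
  by apply: finite_image; exact: finite_finset.
move=> f [fD fB]; exists [ffun x : D => inord (f (val x))] => //.
apply/fsfunP => x; rewrite /mk fsfun_ffun; case: insubP => [u _ <-|/fD -> //].
by rewrite /= ffunE inordK// ltnS.
Qed.

Lemma finite_mtype_le (m : mtype) :
  finite_set [set n : mtype | forall i, (n i <= m i)%N].
Proof.
apply: sub_finite_set (finite_bounded_fsfun (finsupp m)
  (\sum_(i <- finsupp m) m i)%N) => n nm; split=> i.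
  by move=> /fsfun_dflt mi; apply/eqP; rewrite -leqn0 -[leqRHS]mi.
apply: leq_trans (nm i) _; case: finsuppP => // im.
by rewrite (big_fsetD1 i)//= leq_addr.
Qed.

Lemma finite_mdecomp (m : mtype) : finite_set (mdecomp m).
Proof.
apply: sub_finite_set (finite_setX (finite_mtype_le m) (finite_mtype_le m)).
by move=> [a b] /= abm; split=> i; rewrite -abm ?leq_addr ?leq_addl.
Qed.

Lemma finite_composition_families (r : nat) (m : mtype) :
  finite_set (composition_families r m).
Proof.
have [D DE] := finite_fsetP.1 (finite_mtype_le m).
apply: sub_finite_set (finite_bounded_fsfun D r) => k [kr km]; split=> n.
  move=> nD; case: finsuppP => // nk; exfalso; move/negP: nD; apply.
  suff: [set` D] n by [].
  rewrite -DE => i; rewrite -km (big_fsetD1 n)//=.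
  apply: leq_trans (leq_addr _ _); rewrite leq_pmull// lt0n.
  by rewrite -mem_finsupp.
by case: finsuppP => // nk; rewrite -kr (big_fsetD1 n)//= leq_addr.
Qed.

(* Main.v *)
Require Import Defs.
From mathcomp Require Import all_boot all_order all_algebra.
From mathcomp Require Import finmap.
From mathcomp Require Import boolp classical_sets functions cardinality fsbigop.
From mathcomp Require Import ring zify.

(** Put A_r(m) = r (r-1+E)! / ((r+V)! m!), where E and V are the edge and
    vertex weights of m, and A_0 = 1. A direct computation with E = V + |m| gives
    A_{r+1}(m) = A_r(m) + sum_k A_{r+k}(m - e_k). Both m |-> A_{r+s}(m) and the
    convolution of A_r and A_s satisfy this recursion in r with the same initial
    value at r = 0, so induction on |m| and r shows that they agree. Hence
    A_r = A_1^r = S^r.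

    For the multinomial expansion, write r+1 = sum_n k_n in front of
    prod_n C_n^{k_n} / k_n! and remove one copy of n from k: the sum over
    families becomes the convolution of C with the expansion for r. *)

Set Implicit Arguments.
Unset Strict Implicit.
Unset Printing Implicit Defensive.

Import GRing.Theory Num.Theory.

Local Open Scope ring_scope.

(** * Adding and removing one unit at a point of a finitely supported function *)

Section FsfunIncrement.
Variable T : choiceType.
Implicit Types (f : {fsfun T -> nat with 0%N}) (x y : T).

Definition fsincr x f : {fsfun T -> nat with 0%N} :=
  [fsfun f with x |-> (f x).+1].

Definition fsdecr x f : {fsfun T -> nat with 0%N} :=
  [fsfun f with x |-> (f x).-1].

Lemma fsincrE x f y : fsincr x f y = ((y == x) + f y)%N.
Proof. by rewrite /fsincr fsfun_withE; case: eqP => [->|]. Qed.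

Lemma fsdecrE x f y : fsdecr x f y = (f y - (y == x))%N.
Proof.
by rewrite /fsdecr fsfun_withE; case: eqP => [->|]; rewrite ?subn1 ?subn0.
Qed.

Lemma fsincrK x : cancel (fsincr x) (fsdecr x).
Proof. by move=> f; apply/fsfunP => y; rewrite fsdecrE fsincrE addKn. Qed.

Lemma fsdecrK x f : (0 < f x)%N -> fsincr x (fsdecr x f) = f.
Proof.
move=> fx; apply/fsfunP => y; rewrite fsincrE fsdecrE.
by case: eqP => [->|_]; rewrite ?add0n ?subn0 // subnKC.
Qed.

Lemma finsupp_incr x f : finsupp (fsincr x f) = (x |` finsupp f)%fset.
Proof. by rewrite /fsincr finsupp_with. Qed.

Lemma big_finsupp_widen (R : Type) (idx : R) (op : Monoid.com_law idx)
    (D : {fset T}) f (G : T -> nat -> R) :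
    (forall x, G x 0%N = idx) -> (finsupp f `<=` D)%fset ->
  \big[op/idx]_(x <- finsupp f) G x (f x) = \big[op/idx]_(x <- D) G x (f x).
Proof. by move=> G0 fD; apply: big_fset_incl => // x _ /fsfun_dflt ->. Qed.

(** [A] collects the factors at points other than [x], on which both functions agree. Hiding it
    behind an existential lets weighted sums, products of factorials and products of powers all be
    updated without division. *)
Lemma big_finsupp_incr (R : Type) (idx : R) (op : Monoid.com_law idx) x f
    (G : T -> nat -> R) : (forall y, G y 0%N = idx) ->
  exists2 A, \big[op/idx]_(y <- finsupp f) G y (f y) = op (G x (f x)) A &
    \big[op/idx]_(y <- finsupp (fsincr x f)) G y (fsincr x f y)
      = op (G x (f x).+1) A.
Proof.
move=> G0; exists (\big[op/idx]_(y <- (x |` finsupp f) `\ x) G y (f y))%fset.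
  rewrite (@big_finsupp_widen _ _ _ (x |` finsupp f)%fset) ?fsubsetU1 //.
  by rewrite (big_fsetD1 x) ?fset1U1.
rewrite finsupp_incr (big_fsetD1 x) ?fset1U1 //= fsincrE eqxx; congr (op _ _).
rewrite !big_seq; apply: eq_bigr => y; rewrite !inE fsincrE.
by case/andP => /negPf ->.
Qed.

Lemma sum_finsupp_incr x f (g : T -> nat) :
  (\sum_(y <- finsupp (fsincr x f)) g y * fsincr x f y
    = g x + \sum_(y <- finsupp f) g y * f y)%N.
Proof.
have [y|A -> ->] :=
  @big_finsupp_incr _ _ addn x f (fun y n => g y * n)%N; first exact: muln0.
by rewrite mulnS /= addnA.
Qed.

Lemma prod_fact_incr x f :
  (\prod_(y <- finsupp (fsincr x f)) (fsincr x f y)`!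
    = (f x).+1 * \prod_(y <- finsupp f) (f y)`!)%N.
Proof.
have [//|A /= -> ->] := @big_finsupp_incr _ _ muln x f (fun _ n => n`!).
by rewrite factS mulnA.
Qed.

Lemma prod_fact_gt0 f : (0 < \prod_(y <- finsupp f) (f y)`!)%N.
Proof. by apply: prodn_gt0 => y; exact: fact_gt0. Qed.

End FsfunIncrement.

(** Reduces to a rectangle: with [B] the union of all [Q i], each inner sum is padded by [idx] to
    range over [B], and the set [X] records which pairs are genuine. *)
Lemma fsbig_dep_pair (R : Type) (idx : R) (op : Monoid.com_law idx)
    (I J : choiceType) (P : set I) (Q : I -> set J) (F : I -> J -> R) :
    finite_set P -> (forall i, P i -> finite_set (Q i)) ->
  \big[op/idx]_(i \in P) \big[op/idx]_(j \in Q i) F i j =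
  \big[op/idx]_(p \in [set p : I * J | P p.1 /\ Q p.1 p.2]%classic) F p.1 p.2.
Proof.
move=> Pfin Qfin; pose B : set J := (\bigcup_(i in P) Q i)%classic.
have Bfin : finite_set B by apply: bigcup_finite.
pose X : set (I * J) := [set p | p.2 \in Q p.1]%classic.
transitivity (\big[op/idx]_(p \in (P `*` B `&` X)%classic) F p.1 p.2).
  rewrite fsbig_mkcondr.
  rewrite -(pair_fsbig _ (fun i j => if (i, j) \in X then F i j else idx)) //.
  apply: eq_fsbigr => i /set_mem Pi.
  have -> : Q i = (B `&` Q i)%classic.
    by apply/seteqP; split => [j Qj|j []//]; split => //; exists i.
  rewrite fsbig_mkcondr; apply: eq_fsbigr => j _.
  by rewrite [in RHS]/X; congr (if _ then _ else _); apply/idP/idP;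
    rewrite !inE /= ?inE.
apply: eq_fsbigl; apply/seteqP; split => [[i j] [[Pi _]]|[i j] [/= Pi Qj]].
  by rewrite /X /= inE.
by split; [split => //; exists i | rewrite /X /= inE].
Qed.

(** * The unit series and multiplication by a variable *)

Section Series.
Implicit Types (F G : mseries) (m : mtype).

(* Multiplication by the variable t_{i+2}. *)
Definition mseries_shift (i : nat) F : mseries :=
  fun m => if (0 < m i)%N then F (fsdecr i m) else 0.

Lemma mseries_shift_incr i F m : mseries_shift i F (fsincr i m) = F m.
Proof. by rewrite /mseries_shift fsincrE eqxx fsincrK. Qed.

Lemma mtype0P m : (finsupp m == fset0) = (m == [fsfun]).
Proof.
apply/eqP/eqP => [m0|->]; last exact: finsupp0.
by apply/fsfunP => i; rewrite fsfun_dflt ?m0 // fsfunE.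
Qed.

Lemma mseries_oneE m : mseries_one m = (m == [fsfun])%:R.
Proof. by rewrite /mseries_one mtype0P. Qed.

Lemma mseries_mul1 G m : mseries_mul mseries_one G m = G m.
Proof.
rewrite /mseries_mul (fsbigD1 ([fsfun], m)) /=; last 2 first.
- exact: finite_mdecomp.
- by move=> i /=; rewrite fsfunE.
rewrite mseries_oneE eqxx mul1r fsbig1 ?addr0 // => -[a b] [/= abm nab].
rewrite mseries_oneE; case: eqP => [a0|]; rewrite ?mul0r //; case: nab.
by rewrite a0; congr pair; apply/fsfunP => i; rewrite -abm a0 fsfunE.
Qed.

(** Only pairs whose first component is positive at [i] contribute; incrementing that component at
    [i] maps the decompositions of [fsdecr i m] bijectively onto them. *)
Lemma mseries_mul_shift i F G m :
  mseries_mul (mseries_shift i F) G m = mseries_shift i (mseries_mul F G) m.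
Proof.
rewrite {2}/mseries_shift; case: ltnP => [mi|]; last first.
  rewrite leqn0 => /eqP mi; rewrite /mseries_mul fsbig1 // => -[a b] /= abm.
  rewrite /mseries_shift; move: (abm i); rewrite mi => /eqP.
  by rewrite addn_eq0 => /andP[/eqP -> _]; rewrite mul0r.
rewrite /mseries_mul.
pose X : set (mtype * mtype) := [set p : mtype * mtype | (0 < p.1 i)%N]%classic.
transitivity (\sum_(p \in (mdecomp m `&` X)%classic)
                mseries_shift i F p.1 * G p.2).
  apply/esym/fsbig_widen => [p []//|[a b] [/= abm nX]].
  rewrite /mseries_shift; case: ltnP => ai; last by rewrite /= mul0r.
  by exfalso; apply: nX.
rewrite (@reindex_fsbig _ _ _ _ _
  (fun q : mtype * mtype => (fsincr i q.1, q.2)) (mdecomp (fsdecr i m))).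
  by apply: eq_fsbigr => q _; rewrite mseries_shift_incr.
split.
- move=> [a b] /= abm; split; last by rewrite /X /= fsincrE eqxx.
  by move=> j /=; rewrite fsincrE -addnA (abm j) -[in RHS](fsdecrK mi) fsincrE.
- by move=> [a b] [a' b'] _ _ /= [/(can_inj (fsincrK i)) -> ->].
- move=> [a b] [/= abm]; rewrite /X /= => ai; exists (fsdecr i a, b).
    move=> j /=; rewrite !fsdecrE -abm /=; case: eqP => [->|_].
      by rewrite addnBAC.
    by rewrite !subn0.
  by rewrite /= fsdecrK.
Qed.

End Series.

(** * Weights of a type, and the closed form for the coefficients of powers *)

Definition msize (m : mtype) : nat := (\sum_(i <- finsupp m) 1 * m i)%N.

Lemma msize_incr i m : msize (fsincr i m) = (msize m).+1.
Proof. by rewrite /msize sum_finsupp_incr. Qed.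

Lemma edge_weightE m : edge_weight m = (vertex_weight m + msize m)%N.
Proof.
rewrite /edge_weight /vertex_weight /msize -big_split /=.
by apply: eq_bigr => i _; lia.
Qed.

Lemma edge_weight_incr i m :
  edge_weight (fsincr i m) = (i + 2 + edge_weight m)%N.
Proof. exact: (sum_finsupp_incr i m (fun j => (j + 2)%N)). Qed.

Lemma vertex_weight_incr i m :
  vertex_weight (fsincr i m) = (i + 1 + vertex_weight m)%N.
Proof. exact: (sum_finsupp_incr i m (fun j => (j + 1)%N)). Qed.

Lemma mfact_incr i m : mfact (fsincr i m) = ((m i).+1 * mfact m)%N.
Proof. exact: prod_fact_incr. Qed.

Lemma edge_weight_eq0 m : (edge_weight m == 0%N) = (finsupp m == fset0).
Proof.
apply/idP/idP => [|/eqP m0]; last by rewrite /edge_weight m0 big_seq_fset0.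
apply: contraTT => /fset0Pn[i]; rewrite mem_finsupp -lt0n => mi.
by rewrite -(fsdecrK mi) edge_weight_incr; lia.
Qed.

Lemma natr_fact_neq0 n : n`!%:R != 0 :> rat.
Proof. by rewrite pnatr_eq0 -lt0n fact_gt0. Qed.

Lemma mfact_neq0 m : (mfact m)%:R != 0 :> rat.
Proof. by rewrite pnatr_eq0 -lt0n; exact: prod_fact_gt0. Qed.

(* At m = 0 the quotient is already 1 for r > 0, but it is 0 for r = 0, where
   the coefficient of S^0 is 1. *)
Definition raney (r : nat) : mseries := fun m =>
  if finsupp m == fset0 then 1 else
  (r%:R * ((r + edge_weight m).-1)`!%:R)
    / ((r + vertex_weight m)`!%:R * (mfact m)%:R).

Lemma raney0 : raney 0 = mseries_one.
Proof.
by apply/funext => m; rewrite /raney /mseries_one; case: ifP; rewrite ?mul0r.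
Qed.

Lemma raneyS r m :
  raney r.+1 m = (r.+1%:R * (r + edge_weight m)`!%:R)
    / ((r.+1 + vertex_weight m)`!%:R * (mfact m)%:R).
Proof.
rewrite /raney addSn /=; case: ifP => // /eqP m0.
rewrite /edge_weight /vertex_weight /mfact m0 !big_seq_fset0 !addn0 mulr1.
by rewrite -natrM -factS divff // natr_fact_neq0.
Qed.

(* The coefficient form of S^(r+1) = S^r + sum_k t_k S^(r+k). *)
Lemma raney_rec (D : {fset nat}) r m : (finsupp m `<=` D)%fset ->
  raney r.+1 m =
    raney r m + \sum_(i <- D) mseries_shift i (raney (r + i + 2)) m.
Proof.
move=> mD; have [m0|mN0] := eqVneq (finsupp m) fset0.
  rewrite /raney m0 eqxx big1 ?addr0 // => i _.
  by rewrite /mseries_shift fsfun_dflt // m0.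
(* Positivity makes [r + edge_weight m] nonzero even at [r = 0], so its factorial can be unfolded
   below. *)
have E0 : (0 < edge_weight m)%N by rewrite lt0n edge_weight_eq0.
(* Every term is a multiple of [c]. With E, V the weights and |m| the size, the claim becomes
   (r+1)(r+E) = r(r+1+V) + (r|m| + E), which follows from E = V + |m|. *)
set c : rat := ((r + edge_weight m).-1)`!%:R
  / ((r.+1 + vertex_weight m)`!%:R * (mfact m)%:R).
(* The larger exponent exactly offsets the weights lost in m - e_i, so both factorials in [c]
   reappear; only [mfact] changes, by the factor [m i]. *)
have shiftE i : mseries_shift i (raney (r + i + 2)) m
    = ((r + i + 2) * m i)%N%:R * c.
  rewrite /mseries_shift; case: ltnP => [mi|]; last first.
    by rewrite leqn0 => /eqP ->; rewrite muln0 mul0r.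
  rewrite /c; move: (fsdecr i m) (fsdecrK mi) => m' <-.
  rewrite addn2 raneyS edge_weight_incr vertex_weight_incr mfact_incr.
  rewrite fsincrE eqxx add1n.
  have -> : ((r + (i + 2 + edge_weight m')).-1 = (r + i).+1 + edge_weight m')%N
    by lia.
  have -> : (r.+1 + (i + 1 + vertex_weight m') = (r + i).+2 + vertex_weight m')%N
    by lia.
  have := natr_fact_neq0 ((r + i).+2 + vertex_weight m').
  move: (_ + vertex_weight m')%N`! (_ + edge_weight m')%N`! => v e v0.
  by rewrite !natrM; field; rewrite v0 mfact_neq0 nat1r pnatr_eq0.
under eq_bigr do rewrite shiftE.
rewrite -mulr_suml -natr_sum.
have -> : (\sum_(i <- D) (r + i + 2) * m i = r * msize m + edge_weight m)%N.
  rewrite -(@big_finsupp_widen _ _ _ _ _ _ (fun i n => (r + i + 2) * n)%N) //.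
    rewrite /msize /edge_weight big_distrr -big_split /=.
    by apply: eq_bigr => i _; lia.
  by move=> i; rewrite muln0.
rewrite raneyS /raney (negPf mN0).
have -> : ((r + edge_weight m)`!
    = (r + edge_weight m) * (r + edge_weight m).-1`!)%N.
  by case: (r + edge_weight m)%N (ltn_addl r E0).
have := natr_fact_neq0 (r + vertex_weight m).
rewrite /c addSn factS; move: (_ + vertex_weight m)%N`! (_.-1)`! => v e v0.
rewrite edge_weightE !(natrM, natrD); field.
by rewrite v0 mfact_neq0 -natrD nat1r pnatr_eq0.
Qed.

Lemma raney_mul r s m : mseries_mul (raney r) (raney s) m = raney (r + s) m.
Proof.
(* The outer induction on |m| keeps [r] general, since the recursion raises the exponent to
   [r + i + 2] at m - e_i; the inner one is on [r] at fixed [m]. *)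
have [n] := ubnP (msize m); elim: n => // n IHn in r m *; rewrite ltnS => mn.
elim: r => [|r IHr]; first by rewrite raney0 mseries_mul1.
transitivity (mseries_mul (raney r) (raney s) m +
  \sum_(i <- finsupp m)
    mseries_mul (mseries_shift i (raney (r + i + 2))) (raney s) m).
  have fin := finite_mdecomp m; rewrite /mseries_mul !fsbig_finite //.
  under [X in _ = _ + X]eq_bigr do rewrite (fsbig_finite _ _ fin).
  rewrite exchange_big /= -big_split /= !big_seq; apply: eq_bigr => -[a b].
  (* [raney_rec] is applied to [a] with [D] the support of [m], which contains that of [a], so that
     the range of [i] is the same for all decompositions. *)
  rewrite in_fset_set // inE /= => abm; rewrite -mulr_suml -mulrDl -raney_rec //.
  apply/fsubsetP => i; rewrite !mem_finsupp -!lt0n -abm /= => ai.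
  by rewrite (leq_trans ai) // leq_addr.
rewrite IHr addSn (raney_rec (r + s) (fsubset_refl (finsupp m))).
congr (_ + _); apply: eq_bigr => i _; rewrite mseries_mul_shift.
rewrite /mseries_shift; case: ltnP => // mi; rewrite IHn.
  by congr raney; lia.
by move: mn; rewrite -{1}(fsdecrK mi) msize_incr.
Qed.

Lemma hyper_catalan_seriesE : hyper_catalan_series = raney 1.
Proof. by apply/funext => m; rewrite raneyS mul1r add0n. Qed.

Lemma hyper_catalan_powE r m : hyper_catalan_pow r m = raney r m.
Proof.
suff -> : hyper_catalan_pow r = raney r by [].
elim: r => [|r IHr]; first by rewrite raney0.
by apply/funext => m'; rewrite -[RHS](raney_mul 1) -IHr -hyper_catalan_seriesE.
Qed.

(** * Multinomial expansion of the powers of an arbitrary series *)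

Section Families.
Variable F : mseries.
Implicit Types (k : mfamily) (m n : mtype).

(** The summand without its factor r!, so that it depends on [k] alone and removing one copy of a
    type changes it by a simple ratio. *)
Definition family_term k : rat :=
  (\prod_(n <- finsupp k) F n ^+ k n) / (\prod_(n <- finsupp k) (k n)`!)%N%:R.

Lemma family_term_incr n k :
  (fsincr n k n)%:R * family_term (fsincr n k) = F n * family_term k.
Proof.
rewrite /family_term prod_fact_incr natrM.
have [//|A /= -> ->] :=
  @big_finsupp_incr _ _ _ *%R n k (fun n j => F n ^+ j).
have : (\prod_(n <- finsupp k) (k n)`!)%N%:R != 0 :> rat.
  by rewrite pnatr_eq0 -lt0n prod_fact_gt0.
rewrite fsincrE eqxx add1n exprS; move: (_%:R) (F n ^+ k n) => d x d0.
have : (k n).+1%:R != 0 :> rat by rewrite pnatr_eq0.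
by move: (_.+1%:R) (F n) => c y c0; field; rewrite d0.
Qed.

Lemma family_sum_incr n k :
  (\sum_(a <- finsupp (fsincr n k)) fsincr n k a
    = (\sum_(a <- finsupp k) k a).+1)%N.
Proof.
have := sum_finsupp_incr n k (fun=> 1%N).
by under eq_bigr do rewrite mul1n; under [in RHS]eq_bigr do rewrite mul1n.
Qed.

Lemma family_wsum_incr n k i :
  (\sum_(a <- finsupp (fsincr n k)) fsincr n k a * a i
    = n i + \sum_(a <- finsupp k) k a * a i)%N.
Proof.
have := sum_finsupp_incr n k (fun a => a i).
by under eq_bigr do rewrite mulnC; under [in RHS]eq_bigr do rewrite mulnC.
Qed.

Lemma composition_families0 m :
  \sum_(k \in composition_families 0 m) family_term k = mseries_one m.
Proof.
have k0 (k : mfamily) : (\sum_(n <- finsupp k) k n)%N = 0%N -> k = [fsfun].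
  move=> /eqP; rewrite sum_nat_seq_eq0 => /allP k0; apply/fsfunP => n.
  rewrite fsfunE; case: finsuppP => // nk.
  by apply/eqP; apply: k0.
rewrite mseries_oneE; case: eqP => [->|mN0].
  have -> : composition_families 0 [fsfun] = [set [fsfun] : mfamily]%classic.
    apply/seteqP; split => [k [/k0 ->]//|_ ->].
    by split => [|i]; rewrite finsupp0 big_seq_fset0 // fsfunE.
  by rewrite fsbig_set1 /family_term finsupp0 !big_seq_fset0 divr1.
rewrite fsbig1 // => k [/k0 ->] km; case: mN0; apply/fsfunP => i.
by rewrite -km finsupp0 big_seq_fset0 fsfunE.
Qed.

(* Both sides sum over pairs (k, n) with n in the support of k, through
   k = k' + delta_n with k' a family for m - n. *)
Lemma composition_families_rec r m :
  \sum_(p \in mdecomp m)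
     F p.1 * \sum_(k \in composition_families r p.2) family_term k =
  r.+1%:R * \sum_(k \in composition_families r.+1 m) family_term k.
Proof.
under eq_fsbigr do rewrite mulr_fsumr.
rewrite fsbig_dep_pair; last 2 first.
- exact: finite_mdecomp.
- by move=> p _; exact: finite_composition_families.
rewrite mulr_fsumr.
(* The factor r + 1 is the total of [k], hence becomes a sum over the support of [k]. *)
transitivity (\sum_(k \in composition_families r.+1 m)
   \sum_(n \in [set` finsupp k]%classic) (k n)%:R * family_term k); last first.
  apply: eq_fsbigr => k /set_mem[kr _].
  by rewrite -fsbig_seq // -mulr_suml -natr_sum kr.
rewrite fsbig_dep_pair; last 2 first.
- exact: finite_composition_families.
- by move=> k _; exact: finite_fset.
rewrite [RHS](@reindex_fsbig _ _ _ _ _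
  (fun q : (mtype * mtype) * mfamily => (fsincr q.1.1 q.2, q.1.1))
  [set q : (mtype * mtype) * mfamily |
    mdecomp m q.1 /\ composition_families r q.1.2 q.2]%classic).
  by apply: eq_fsbigr => -[[a b] k] _ /=; rewrite family_term_incr.
split.
- move=> [[a b] k] /= [abm [kr kb]]; split.
    by split => [|i]; rewrite ?family_sum_incr ?kr // family_wsum_incr kb abm.
  by rewrite /= finsupp_incr fset1U1.
- move=> [[a b] k] [[a' b'] k'].
  move=> /set_mem[/= abm [_ kb]] /set_mem[/= abm' [_ kb']] [kk' aa'].
  (* Once the families agree, [b] and [b'] do too: each is the weighted sum of its family. *)
  rewrite -aa' in kk' *; rewrite (can_inj (fsincrK a) kk') in kb *.
  by congr (_, _, _); apply/fsfunP => i; rewrite -kb -kb'.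
- move=> [k n] [[kr km]]; rewrite /= mem_finsupp -lt0n => kn.
  have kE := fsdecrK kn; move: (fsdecr n k) kE kr km => k' <-.
  rewrite family_sum_incr => -[k'r] km.
  (* The subtraction never truncates: [n] occurs in the original family, so [m] is [n] plus the
     weighted sum of [k']. *)
  pose b : mtype := [fsfun i in finsupp m => (m i - n i)%N].
  have bE i : b i = (\sum_(a <- finsupp k') k' a * a i)%N.
    rewrite fsfunE; case: ifP => [_|/negbT/fsfun_dflt mi].
      by rewrite -km family_wsum_incr addKn.
    move: (km i); rewrite family_wsum_incr mi => /eqP.
    by rewrite addn_eq0 => /andP[_ /eqP ->].
  exists ((n, b), k') => //; split => [i|]; last by split.
  by rewrite /= bE -km family_wsum_incr.
Qed.

(** Induction on [r]: the factor r + 1 needed by [composition_families_rec] comes from (r+1)! =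
    (r+1) r!. *)
Lemma mseries_exp_families r m :
  mseries_exp F r m =
    r`!%:R * \sum_(k \in composition_families r m) family_term k.
Proof.
elim: r => [|r IHr] in m *; first by rewrite composition_families0 mul1r.
rewrite factS mulnC natrM -mulrA -composition_families_rec mulr_fsumr.
rewrite /mseries_exp iterS /mseries_mul; apply: eq_fsbigr => p _.
by rewrite -[iter _ _ _ _]/(mseries_exp F r p.2) IHr mulrCA.
Qed.

End Families.

Theorem theorem4 (r : nat) (m : mtype) (r_gt0 : (0 < r)%N) :
  hyper_catalan_pow r m =
    (r%:R * (r - 1 + edge_weight m)`!%:R)
      / ((r + vertex_weight m)`!%:R * (mfact m)%:R)
  /\
  hyper_catalan_pow r m =
    \sum_(k \in composition_families r m)
      family_multinomial r k *
      \prod_(n <- finsupp k) hyper_catalan n ^+ k n.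
Proof.
split.
  by rewrite hyper_catalan_powE; case: r r_gt0 => // r _; rewrite raneyS subn1.
rewrite /hyper_catalan_pow mseries_exp_families mulr_fsumr.
apply: eq_fsbigr => k _; rewrite /family_term /family_multinomial.
by rewrite [X in _ * X]mulrC mulrA.
Qed.
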